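(* Let $(X,d)$ be a compact metric space and $T\colon X\to X$ a continuous transformation. Let $\phi\colon X\to\mathbb{R}$ be continuous, and let $(s_n)_{n\ge0}$ be a monotone decreasing (nonincreasing) sequence of positive reals such that $S_n:=\sum_{k=0}^{n-1}s_k\to\infty$ and $\limsup_{n\to\infty}\frac{S_n}{ns_n}<\infty$. Then for every $\alpha\in\mathbb{R}$, $$E_\phi(\alpha)=E_\phi^s(\alpha).$$ In particular, $h_{\rm top}(E_\phi(\alpha))=h_{\rm top}(E_\phi^s(\alpha))$, $\dim_{\rm H}E_\phi(\alpha)=\dim_{\rm H}E_\phi^s(\alpha)$ and $\dim_{\rm P}E_\phi(\alpha)=\dim_{\rm P}E_\phi^s(\alpha)$.
   Context: For $\alpha\in\mathbb{R}$, $$E_\phi(\alpha)=\Big\{x\in X:\lim_{n\to\infty}\frac1n\sum_{k=0}^{n-1}\phi(T^kx)=\alpha\Big\},\qquad E_\phi^s(\alpha)=\Big\{x\in X:\lim_{n\to\infty}\frac1{S_n}\sum_{k=0}^{n-1}s_k\phi(T^kx)=\alpha\Big\}.$$ $\dim_{\rm H}$ and $\dim_{\rm P}$ denote Hausdorff dimension and packing (Tricot) dimension with respect to the metric $d$; $h_{\rm top}(E)$ denotes the topological entropy with respect to $T$ of a (not necessarily compact or invariant) subset $E\subseteq X$, in the sense of Bowen. *)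

(* Defs.v *)
From HB Require Import structures.
From mathcomp Require Import all_boot all_order all_algebra.
From mathcomp Require Import all_classical all_reals all_analysis.

Set Implicit Arguments.
Unset Strict Implicit.
Unset Printing Implicit Defensive.

Import Order.TTheory GRing.Theory Num.Theory.
Import numFieldNormedType.Exports.

Local Open Scope classical_set_scope.
Local Open Scope ring_scope.

Definition birkhoff_level_set {R : realType} {X : Type}
    (T : X -> X) (phi : X -> R) (alpha : R) : set X :=
  [set x | n%:R^-1 * (\sum_(0 <= k < n) phi (iter k T x)) @[n --> \oo]
             --> alpha].

(* [series s n] is the partial sum of the terms of index k < n. *)
Definition weighted_level_set {R : realType} {X : Type}
    (T : X -> X) (s : R^nat) (phi : X -> R) (alpha : R) : set X :=
  [set x | (series s n)^-1 * (\sum_(0 <= k < n) s k * phi (iter k T x))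
             @[n --> \oo] --> alpha].

Local Open Scope ereal_scope.

Definition covers {X : Type} (C : set (set X)) (E : set X) : Prop :=
  E `<=` \bigcup_(U in C) U.

Section dimensions.
Context {R : realType} {X : metricType R}.
Implicit Types (E U : set X) (t delta : R).

(* Adjoining 0 only matters for the empty set. *)
Definition diam U : \bar R :=
  ereal_sup (0 |` [set (mdist p.1 p.2)%:E | p in U `*` U]).

(* Families of sets, rather than sequences, may be finite or empty; with the
   convention 0 `^ 0 = 1 this makes the case t = 0 the counting measure. *)
Definition hausdorff_premeasure t delta E : \bar R :=
  ereal_inf [set \esum_(U in C) (diam U `^ t) | C in
    [set C : set (set X) | [/\ countable C, covers C E &
       forall U, C U -> diam U <= delta%:E]]].

Definition hausdorff_measure t E : \bar R :=
  ereal_sup [set hausdorff_premeasure t delta E | delta in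
    [set delta | (0 < delta)%R]].

Definition hausdorff_dim E : \bar R :=
  ereal_inf [set t%:E | t in
    [set t | (0 <= t)%R /\ hausdorff_measure t E = 0]].

(* The library's [closed_ball] is the closure of the open ball, which can be
   smaller in a general metric space. *)
Definition metric_closed_ball (x : X) (r : R) : set X :=
  [set y | (mdist x y <= r)%R].

(* A packing is a family of pairs (centre, radius). *)
Definition is_packing delta E (B : set (X * R)) : Prop :=
  [/\ countable B,
      forall b, B b -> [/\ E b.1, (0 < b.2)%R & (2 * b.2 <= delta)%R] &
      trivIset B (fun b => metric_closed_ball b.1 b.2)].

(* In a general metric space the diameter of a ball may be less than twice its
   radius: as usual there, 2r is used as the size of a ball of radius r. *)
Definition packing_presum t delta E : \bar R :=
  ereal_sup [set \esum_(b in B) (((2 * b.2) `^ t)%R)%:E | B in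
    [set B | is_packing delta E B]].

Definition packing_premeasure t E : \bar R :=
  ereal_inf [set packing_presum t delta E | delta in
    [set delta | (0 < delta)%R]].

Definition packing_measure t E : \bar R :=
  ereal_inf [set \esum_(F in C) packing_premeasure t F | C in
    [set C : set (set X) | countable C /\ covers C E]].

Definition packing_dim E : \bar R :=
  ereal_inf [set t%:E | t in
    [set t | (0 <= t)%R /\ packing_measure t E = 0]].

End dimensions.

(* Bowen's definition (Topological entropy for noncompact sets, 1973). *)
Section bowen_entropy.
Context {R : realType} {X : topologicalType} (T : X -> X).
Implicit Types (E Y : set X) (A : set (set X)) (lambda eps : R).

(* The largest n such that each of E, T E, ..., T^(n-1) E lies in an element
   of A, or +oo if all the images T^k E do. *)
Definition escape_time A E : \bar R :=
  ereal_sup [set n%:R%:E | n in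
    [set n : nat | forall k, (k < n)%N ->
       exists2 V, A V & iter k T @` E `<=` V]].

Definition bowen_size A E : \bar R := expeR (- escape_time A E).

Definition bowen_premeasure A lambda eps Y : \bar R :=
  ereal_inf [set \esum_(E in C) (bowen_size A E `^ lambda) | C in
    [set C : set (set X) | [/\ countable C, covers C Y &
       forall E, C E -> bowen_size A E < eps%:E]]].

Definition bowen_measure A lambda Y : \bar R :=
  ereal_sup [set bowen_premeasure A lambda eps Y | eps in
    [set eps | (0 < eps)%R]].

Definition bowen_entropy_cover A Y : \bar R :=
  ereal_inf [set lambda%:E | lambda in
    [set lambda | (0 <= lambda)%R /\ bowen_measure A lambda Y = 0]].

Definition bowen_entropy Y : \bar R :=
  ereal_sup [set bowen_entropy_cover A Y | A in
    [set A : set (set X) | [/\ finite_set A, forall V, A V -> open V &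
       covers A [set: X]]]].

End bowen_entropy.

(* Main.v *)
Require Import Defs.
From mathcomp Require Import all_boot all_order all_algebra.
From mathcomp Require Import all_classical all_reals all_analysis.
From mathcomp Require Import ring lra.

(** The two level sets are equal because, for an arbitrary real sequence [a],
    the Cesaro means of [a] converge to [alpha] if and only if its [s]-weighted
    means do; the dynamics only supplies [a k = phi (iter k T x)].  Once the
    sets are equal, so are their entropies and dimensions.

    Put [b k = a k - alpha], [S = series s] and write [s b] for the termwise
    product.  Convergence of the weighted means says exactly that
    [series (s b)] is [o(S)], and for constant weights that [series b n] is
    [o(n)] ([weighted_mean_cvgP]).  One passes between the two by summation
    by parts.

    From Cesaro to weighted means the factor [s] is nonincreasing.  A bound
    [|series b n| <= e n + K] survives multiplication of the terms by such a
    factor, and becomes [|series (s b) n| <= e S_n + K s_0]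
    ([series_mul_nonincreasing_ge]); the second term is negligible since [S]
    diverges.

    Backwards the factor is [1 / s], nondecreasing, and a bound [M] for the
    partial sums of [s b] up to [n] costs a factor [2 / s_n]
    ([ler_norm_series_mul_nondecreasing]).  With [M = e S_n + K] this gives
    [|series b n| <= 2 (e S_n + K) / s_n], and it is here that the hypothesis
    on the upper limit is needed: it says that [S_n / s_n] is at most [C n]. *)

Set Implicit Arguments.
Unset Strict Implicit.
Unset Printing Implicit Defensive.

Import Order.TTheory GRing.Theory Num.Theory.
Import numFieldNormedType.Exports.

Local Open Scope classical_set_scope.
Local Open Scope ring_scope.

(** A bound that holds eventually holds everywhere up to an additive constant,
    which is the form that summation by parts can use. *)
Lemma near_ler_normD (R : realType) (W P : R^nat) :
  (forall n, 0 <= P n) ->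
  (\forall n \near \oo, `|W n| <= P n) ->
  exists2 K, 0 <= K & forall n, `|W n| <= P n + K.
Proof.
move=> P0 [N _ HN]; exists (\sum_(i < N) `|W i|); first exact: sumr_ge0.
move=> n; have [Nn|nN] := leqP N n.
  by rewrite (le_trans (HN n Nn))// lerDl sumr_ge0.
rewrite (bigD1 (Ordinal nN))//= addrCA lerDl.
by rewrite addr_ge0// sumr_ge0.
Qed.

(** Subtracting [alpha] from each term turns the weighted mean into its
    deviation from [alpha], because the weights are normalised by their sum. *)
Lemma weighted_mean_cvgP (R : realType) (p a : R^nat) (alpha : R) :
  series p n @[n --> \oo] --> +oo ->
  ((series p n)^-1 * (\sum_(0 <= k < n) p k * a k) @[n --> \oo] --> alpha) <->
  (forall e, 0 < e -> \forall n \near \oo,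
    `|series (fun k => p k * (a k - alpha)) n| <= e * series p n).
Proof.
move=> /cvgryPgt Poo.
have devE n : 0 < series p n ->
    `|alpha - (series p n)^-1 * (\sum_(0 <= k < n) p k * a k)| =
    `|series (fun k => p k * (a k - alpha)) n| / series p n.
  move=> P0.
  have -> : series (fun k => p k * (a k - alpha)) n =
      \sum_(0 <= k < n) p k * a k - series p n * alpha.
    rewrite !seriesEnat/= mulr_suml -sumrB.
    by apply: eq_bigr => k _; rewrite mulrBr.
  rewrite -[X in _ = _ / X](gtr0_norm P0) -normfV -normrM distrC; congr `|_|.
  by field; rewrite gt_eqF.
split.
  move=> /cvgrPdist_le cvga e e0; near=> n.
  have P0 : 0 < series p n by near: n; exact: Poo.
  rewrite -ler_pdivrMr// -devE//.
  by near: n; exact: cvga.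
move=> small; apply/cvgrPdist_le => e e0; near=> n.
have P0 : 0 < series p n by near: n; exact: Poo.
rewrite devE// ler_pdivrMr//.
by near: n; exact: small.
Unshelve. all: by end_near. Qed.

(** Summation by parts for a nonincreasing factor: it shrinks any surplus that
    the partial sums have accumulated, so that they stay bounded below. *)
Lemma series_mul_nonincreasing_ge (R : realType) (r u : R^nat) (K : R) :
  (forall n, 0 <= r n) -> nonincreasing_seq r ->
  (forall n, - K <= series u n) ->
  forall n, - (K * r 0%N) <= series (fun k => r k * u k) n.
Proof.
move=> r0 rdecr uK n.
(* The surplus over the lower bound is kept in the induction hypothesis. *)
have : r n * (series u n + K) - K * r 0%N <= series (fun k => r k * u k) n.
  elim: n => [|n IH]; first by rewrite !seriesEnat/= !big_nil; lra.
  rewrite [X in _ <= X]seriesSr.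
  have : r n.+1 * (series u n.+1 + K) <= r n * (series u n.+1 + K).
    by rewrite ler_wpM2r ?rdecr//; have := uK n.+1; lra.
  by rewrite seriesSr; lra.
by apply: le_trans; have := uK n; have := r0 n; nra.
Qed.

(** Summation by parts for a nondecreasing factor: the boundary term and the
    telescoping sum of the increments of [r] each contribute at most
    [M * r n]. *)
Lemma ler_norm_series_mul_nondecreasing (R : realType) (r w : R^nat) (M : R)
    (n : nat) :
  (forall k, 0 <= r k) -> nondecreasing_seq r ->
  (forall k, (k <= n)%N -> `|series w k| <= M) ->
  `|series (fun k => r k * w k) n| <= 2 * M * r n.
Proof.
move=> r0 rincr wM.
have byparts : `|series (fun k => r k * w k) n - r n * series w n| <=
    M * (r n - r 0%N).
  elim: n wM => [|n IH] wM.
    by rewrite !seriesEnat/= !big_nil mulr0 !subrr normr0 mulr0.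
  have {}IH := IH (fun k kn => wM k (leqW kn)).
  have -> : series (fun k => r k * w k) n.+1 - r n.+1 * series w n.+1 =
      (series (fun k => r k * w k) n - r n * series w n) -
      (r n.+1 - r n) * series w n.+1.
    by rewrite !seriesSr; ring.
  rewrite (le_trans (ler_normB _ _))//.
  have rn : 0 <= r n.+1 - r n by rewrite subr_ge0 rincr.
  have : `|(r n.+1 - r n) * series w n.+1| <= (r n.+1 - r n) * M.
    by rewrite normrM ger0_norm// ler_wpM2l// wM.
  by lra.
have bdry : `|r n * series w n| <= r n * M.
  by rewrite normrM ger0_norm// ler_wpM2l// wM.
have M0 : 0 <= M by exact: le_trans (normr_ge0 _) (wM n (leqnn n)).
rewrite -[X in `|X|](subrK (r n * series w n)) (le_trans (ler_normD _ _))//.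
have := mulr_ge0 M0 (r0 0%N).
by lra.
Qed.

Lemma small_series_mul_nonincreasing (R : realType) (s b : R^nat) :
  (forall n, 0 < s n) -> nonincreasing_seq s ->
  series s n @[n --> \oo] --> +oo ->
  (forall e, 0 < e -> \forall n \near \oo, `|series b n| <= e * n%:R) ->
  forall e, 0 < e -> \forall n \near \oo,
    `|series (fun k => s k * b k) n| <= e * series s n.
Proof.
move=> s0 sdecr /cvgryPge Soo small e e0.
have e20 : 0 < e / 2 by lra.
have [K K0 bK] := near_ler_normD
  (fun n => mulr_ge0 (ltW e20) (ler0n R n)) (small _ e20).
(* Taking [c = 1] and [c = -1] gives the two sides of the absolute value. *)
have lower (c : R) : `|c| = 1 -> forall n,
    - (K * s 0%N) <= e / 2 * series s n + c * series (fun k => s k * b k) n.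
  move=> c1 n.
  have -> : e / 2 * series s n + c * series (fun k => s k * b k) n =
      series (fun k => s k * (e / 2 + c * b k)) n.
    rewrite !seriesEnat/= !mulr_sumr -big_split/=.
    by apply: eq_bigr => k _; ring.
  apply: series_mul_nonincreasing_ge => // [k|m]; first exact: ltW.
  have -> : series (fun k => e / 2 + c * b k) m = e / 2 * m%:R + c * series b m.
    rewrite !seriesEnat/= mulr_sumr big_split/= sumr_const_nat subn0.
    by rewrite mulr_natr.
  have : `|c * series b m| <= e / 2 * m%:R + K by rewrite normrM c1 mul1r.
  by rewrite ler_norml => /andP[]; lra.
near=> n.
have : K * s 0%N / (e / 2) <= series s n by near: n; exact: Soo.
rewrite ler_pdivrMr// => nlarge.
have := lower 1 (normr1 _) n; have := lower (-1) (normrN1 _) n.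
by rewrite ler_norml; move=> *; apply/andP; split; lra.
Unshelve. all: by end_near. Qed.

Lemma small_series_div_nonincreasing (R : realType) (s b : R^nat) (C : R) :
  (forall n, 0 < s n) -> nonincreasing_seq s ->
  series s n @[n --> \oo] --> +oo ->
  0 < C -> (\forall n \near \oo, series s n <= C * (n%:R * s n)) ->
  (forall e, 0 < e -> \forall n \near \oo,
    `|series (fun k => s k * b k) n| <= e * series s n) ->
  forall e, 0 < e -> \forall n \near \oo, `|series b n| <= e * n%:R.
Proof.
move=> s0 sdecr /cvgryPge Soo C0 SC small e e0.
have Sincr : nondecreasing_seq (series s).
  by apply/nondecreasing_seqP => n; rewrite seriesSr lerDl ltW.
have S0 n : 0 <= series s n.
  by rewrite seriesEnat/= sumr_ge0// => k _; exact: ltW.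
(* Bounding the series costs a factor 2, absorbing [K] another one, and
   comparing [S_n / s_n] with [n] a factor [C]. *)
set d := e / (4 * C).
have d0 : 0 < d by rewrite divr_gt0// mulr_gt0.
have [K K0 sbK] := near_ler_normD
  (fun n => mulr_ge0 (ltW d0) (S0 n)) (small _ d0).
have bE : b = fun k => (s k)^-1 * (s k * b k).
  by apply/funext => k; rewrite mulKf// gt_eqF.
near=> n.
have : K / d <= series s n by near: n; exact: Soo.
rewrite ler_pdivrMr// => nlarge.
have Sn : series s n <= C * (n%:R * s n) by near: n.
have : `|series b n| <= 2 * (d * series s n + K) * (s n)^-1.
  rewrite [in X in X <= _]bE.
  apply: ler_norm_series_mul_nondecreasing => [k|i j ij|k kn].
  - by rewrite invr_ge0 ltW.
  - by rewrite lef_pV2 ?posrE// sdecr.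
  - by rewrite (le_trans (sbK k))// lerD2r ler_wpM2l ?(ltW d0)// Sincr.
move=> /le_trans; apply; rewrite ler_pdivrMr//.
have -> : e * n%:R * s n = 4 * (d * (C * (n%:R * s n))).
  by rewrite /d; field; rewrite gt_eqF.
have := ler_wpM2l (ltW d0) Sn.
by lra.
Unshelve. all: by end_near. Qed.

Lemma limn_esup_lt_pinfty_near_le (R : realType) (u : R^nat) :
  (limn_esup (fun n => (u n)%:E) < +oo)%E ->
  exists2 C, 0 < C & \forall n \near \oo, u n <= C.
Proof.
move=> /ereal_inf_lt[_ [V Voo <-] supV].
have uV n : V n -> ((u n)%:E <= ereal_sup [set (u n)%:E | n in V])%E.
  by move=> Vn; apply: ereal_sup_ubound; exists n.
case: ereal_sup supV uV => [c| |]// _ uV; last first.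
  exists 1 => //; apply: filterS Voo => n /uV.
  by rewrite leeNy_eq.
exists (Num.max 1 c); first by rewrite lt_max ltr01.
by apply: filterS Voo => n /uV; rewrite lee_fin le_max orbC => ->.
Qed.

(** Cesaro means are the weighted means for the constant weight 1, so that one
    criterion describes both limits and only smallness has to be transferred. *)
Lemma cesaro_cvg_weighted_mean (R : realType) (s a : R^nat) (alpha : R) :
  (forall n, 0 < s n) -> nonincreasing_seq s ->
  series s n @[n --> \oo] --> +oo ->
  (limn_esup (fun n => (series s n / (n%:R * s n))%:E) < +oo)%E ->
  (n%:R^-1 * (\sum_(0 <= k < n) a k) @[n --> \oo] --> alpha) <->
  ((series s n)^-1 * (\sum_(0 <= k < n) s k * a k) @[n --> \oo] --> alpha).
Proof.
move=> s0 sdecr Soo /limn_esup_lt_pinfty_near_le[C C0 SC].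
have SCn : \forall n \near \oo, series s n <= C * (n%:R * s n).
  near=> n.
  have n0 : (0 < n)%N by near: n; exact: nbhs_infty_gt.
  by rewrite -ler_pdivrMr ?mulr_gt0 ?ltr0n//; near: n.
have one_seriesE : series (fun=> 1 : R) = (fun n => n%:R).
  by apply/funext => n; rewrite seriesEnat/= sumr_const_nat subn0.
have oneoo : series (fun=> 1 : R) n @[n --> \oo] --> +oo.
  by rewrite one_seriesE; exact: cvgr_idn.
have mul1 (c : R^nat) : (fun k => 1 * c k) = c.
  by apply/funext => k; rewrite mul1r.
have := weighted_mean_cvgP a alpha oneoo.
rewrite one_seriesE (mul1 (fun k => a k - alpha)).
under [X in (X @ _ --> _) <-> _]eq_fun do
  under eq_bigr do rewrite mul1r.
move=> cesaroP.
have weightedP := weighted_mean_cvgP a alpha Soo.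
split=> [/cesaroP small|/weightedP small].
  apply/weightedP.
  exact: (small_series_mul_nonincreasing (b := fun k => a k - alpha)).
by apply/cesaroP; exact: small_series_div_nonincreasing C0 SCn small.
Unshelve. all: by end_near. Qed.

Theorem corollary1p2 (R : realType) (X : metricType R) (T : X -> X)
    (phi : X -> R) (s : R^nat) :
  compact [set: X] ->
  continuous T ->
  continuous phi ->
  (forall n, 0 < s n) ->
  nonincreasing_seq s ->
  series s n @[n --> \oo] --> +oo ->
  (limn_esup (fun n => (series s n / (n%:R * s n))%:E) < +oo)%E ->
  forall alpha : R,
    [/\ birkhoff_level_set T phi alpha = weighted_level_set T s phi alpha,
        bowen_entropy T (birkhoff_level_set T phi alpha)
          = bowen_entropy T (weighted_level_set T s phi alpha) :> \bar R,
        hausdorff_dim (birkhoff_level_set T phi alpha)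
          = hausdorff_dim (weighted_level_set T s phi alpha) &
        packing_dim (birkhoff_level_set T phi alpha)
          = packing_dim (weighted_level_set T s phi alpha)].
Proof.
move=> _ _ _ s0 sdecr Soo Slim alpha.
suff -> : birkhoff_level_set T phi alpha = weighted_level_set T s phi alpha.
  by [].
by apply/seteqP; split=> x /=;
  have [] := cesaro_cvg_weighted_mean (fun k => phi (iter k T x)) alpha
    s0 sdecr Soo Slim.
Qed.
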